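(* Let $S_{n,q}$ be the spider with $q$ legs, all of length two, so that it has $n=2q+1$ vertices. Then $c_3(S_{n,q})\ge \frac{17(n-1)}{16}-3$.
   Context: All graphs are finite and simple. A spider with $q$ legs is a tree obtained from $q$ paths (the legs), each with at least one edge, by identifying one endpoint of each into a single vertex (the center); the length of a leg is its number of edges. Let $G$ be a graph and $k\ge 2$ an integer. A multiset $\mathscr{P}$ of paths in $G$ is a $k$-rainbow separating path system ($k$-RSPS) if its elements can be colored with (at most) $k$ colors so that for every pair of distinct edges $e_1,e_2\in E(G)$ there exist paths $P_1,P_2\in\mathscr{P}$ of distinct colors such that $P_1$ contains $e_1$ but not $e_2$, and $P_2$ contains $e_2$ but not $e_1$. The $k$-rainbow separation number $c_k(G)$ is the smallest cardinality (with multiplicity) of a $k$-RSPS of $G$. *)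

(* Defs.v *)
From mathcomp Require Import all_boot all_order all_algebra.
From mathcomp Require Import boolp.
Set Implicit Arguments.
Unset Strict Implicit.
Unset Printing Implicit Defensive.

Record sgraph := SGraph {
  vertex :> finType;
  adj : rel vertex;
  adj_sym : symmetric adj;
  adj_irr : irreflexive adj
}.

Definition edges (G : sgraph) : {set {set G}} :=
  [set [set u.1; u.2] | u : G * G & adj u.1 u.2].

(* A path is given by its list of vertices, read from either end; the two
   readings have the same edges.  Single vertices count as (edgeless) paths. *)
Definition is_path (G : sgraph) (p : seq G) : bool :=
  [&& p != [::], sorted (@adj G) p & uniq p].

Definition path_edges (G : sgraph) (p : seq G) : seq {set G} :=
  if p is x :: s then pairmap (fun u v => [set u; v]) x s else [::].

(* A multiset of paths is a list of paths, considered up to order; colors are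
   attached to positions, so that copies of one path may differ in color. *)
Definition is_rsps (G : sgraph) (k : nat) (P : seq (seq G)) : Prop :=
  all (@is_path G) P /\
  exists c : 'I_(size P) -> 'I_k,
    forall e1 e2 : {set G}, e1 \in edges G -> e2 \in edges G -> e1 != e2 ->
    exists i1 i2 : 'I_(size P),
      [/\ c i1 != c i2,
          (e1 \in path_edges (nth [::] P i1))
            && (e2 \notin path_edges (nth [::] P i1))
        & (e2 \in path_edges (nth [::] P i2))
            && (e1 \notin path_edges (nth [::] P i2))].

(* Take every edge twice, once in each of two colors. *)
Lemma rsps_exists (G : sgraph) (k : nat) (hk : 1 < k) :
  exists m, `[< exists2 P : seq (seq G), is_rsps k P & size P = m >].
Proof.
pose S := [seq [:: u.1; u.2] | u <- enum [pred u : G * G | adj u.1 u.2]].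
exists (size (S ++ S)); apply/asboolP; exists (S ++ S) => //.
have allS : all (@is_path G) S.
  apply/allP => p /mapP[u]; rewrite mem_enum inE => uv ->.
  rewrite /is_path /= uv inE !andbT; apply/eqP => uE.
  by move: uv; rewrite uE adj_irr.
split; first by rewrite all_cat allS.
exists (fun i => if i < size S then Ordinal (ltnW hk) else Ordinal hk).
have edgeS e : e \in edges G ->
    exists2 i, i < size S & path_edges (nth [::] S i) = [:: e].
  case/imsetP => u; rewrite inE => uv ->.
  have uS : [:: u.1; u.2] \in S.
    by apply/mapP; exists u => //; rewrite mem_enum inE.
  by exists (index [:: u.1; u.2] S); rewrite ?index_mem // nth_index.
move=> e1 e2 /edgeS[i1 h1 p1] /edgeS[i2 h2 p2] ne.
have h1' : i1 < size (S ++ S) by rewrite size_cat ltn_addr.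
have h2' : size S + i2 < size (S ++ S) by rewrite size_cat ltn_add2l.
exists (Ordinal h1'), (Ordinal h2') => /=.
rewrite !nth_cat h1 ltnNge leq_addr /= addKn p1 p2 !inE !eqxx /=.
by split=> //; rewrite eq_sym.
Qed.

Definition rainbow_sep_number (G : sgraph) (k : nat) (hk : 1 < k) : nat :=
  ex_minn (rsps_exists G hk).

(* The spider whose i-th leg has length l i >= 1: None is the center and
   (i, j) is the vertex of leg i at distance j + 1 from the center.  A leg of
   length 0, which is not allowed in a spider, would be invisible here. *)
Section Spider.
Variables (q : nat) (l : 'I_q -> nat).

Local Notation spider_vertex := (option {i : 'I_q & 'I_(l i)}).

Definition spider_succ (u v : spider_vertex) : bool :=
  match u, v with
  | None, Some b => val (tagged b) == 0
  | Some a, Some b =>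
      (tag a == tag b) && (val (tagged b) == (val (tagged a)).+1)
  | _, None => false
  end.

Definition spider_adj (u v : spider_vertex) : bool :=
  spider_succ u v || spider_succ v u.

Lemma spider_adj_sym : symmetric spider_adj.
Proof. by move=> u v; rewrite /spider_adj orbC. Qed.

Lemma spider_adj_irr : irreflexive spider_adj.
Proof.
move=> [a|] //; rewrite /spider_adj /= orbb eqxx /=.
by rewrite -[X in X == _]addn0 -addn1 eqn_add2l.
Qed.

Definition spider : sgraph := SGraph spider_adj_sym spider_adj_irr.

End Spider.

Lemma card_spider (q : nat) (l : 'I_q -> nat) :
  #|spider l| = (\sum_(i < q) l i).+1.
Proof.
rewrite [LHS]card_option card_tagged sumnE big_map big_enum /=.
by congr _.+1; apply: eq_bigr => i _; rewrite card_ord.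
Qed.

Definition spider2 (q : nat) : sgraph := spider (fun _ : 'I_q => 2).

Lemma card_spider2 (q : nat) : #|spider2 q| = 2 * q + 1.
Proof. by rewrite card_spider sum_nat_const card_ord mulnC addn1. Qed.

(* Main.v *)
Require Import Defs.
From mathcomp Require Import all_boot all_order all_algebra.
From mathcomp Require Import boolp zify lra.
Import Order.TTheory GRing.Theory Num.Theory.

(** The bound is a discharging argument.  In the leg i of the spider, let a_i be
the edge at the center and b_i the edge at the leaf.  Only two facts about
paths matter: a path through b_i that avoids a_i has no other edge
([path_tip_alone]), and a path meets at most two of the edges a_i, since each
of them uses one of the two neighbors of the center ([path_card_inner]).

Call an edge monochromatic if all paths through it have the same color.  Two
monochromatic edges of the same color cannot be separated by paths of distinct
colors, so with three colors there are at most three such edges; the at most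
three legs containing one are exceptional.  Every leg i has a path equal to
b_i alone and another one through a_i.  If i is not exceptional, at least two
paths pass through a_i.

Give every path eight units of charge, to be distributed among the legs it
meets.  If a path goes through two legs and is split evenly, the only
non-exceptional legs that may receive less than 17 units are the tight ones:
one path b_i, and exactly two paths through a_i, both crossing to another leg;
they get 8 + 4 + 4 = 16.  In a tight leg, the path b_i, the path through a_i
only and the path through a_i and b_i have three distinct colors
([tight_structure]).  If the last one reached another tight leg j, the second
path through a_j would have to avoid all three colors ([tight_not_joined]).
So that path leads to a leg that is not tight, and it may be split 5 + 3
instead of 4 + 4.  This brings tight legs to 17.  A non-exceptional leg that is
not tight still has at least 17 units even if all its crossing paths give it
only 3, and an exceptional leg has at least 9.  With m paths and q legs,
17 q - 8 * 3 <= 8 m, which is the claim because n - 1 = 2 q. *)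

(** * Discharging in an abstract system of legs *)

(** The argument is carried out for a family T of paths described only by its
incidence with the edges a_i (relation [inn]) and b_i (relation [out]) for i
in L.  An edge is a pair of a leg and a boolean, which is true for b_i. *)
Section Discharging.
Set Implicit Arguments.
Unset Strict Implicit.

Variables (T L C : finType) (inn out : T -> L -> bool) (c : T -> C).

Definition contains (P : T) (e : L * bool) :=
  if e.2 then out P e.1 else inn P e.1.

Hypothesis card_color : #|C| <= 3.
Hypothesis tip_alone : forall P i e,
  out P i -> ~~ inn P i -> contains P e -> e = (i, true).
Hypothesis card_legs : forall P, #|[set i | inn P i]| <= 2.
Hypothesis separated : forall e f : L * bool, e != f -> exists P Q,
  [/\ c P != c Q, contains P e && ~~ contains P f
    & contains Q f && ~~ contains Q e].

Definition monochromatic e :=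
  [forall P, forall Q, contains P e ==> contains Q e ==> (c P == c Q)].

Lemma monochromaticP e :
  reflect (forall P Q, contains P e -> contains Q e -> c P = c Q)
          (monochromatic e).
Proof.
apply: (iffP forallP) => [mono P Q Pe Qe|mono P].
  by move/forallP/(_ Q): (mono P); rewrite Pe Qe => /eqP.
by apply/forallP => Q; apply/implyP => Pe; apply/implyP => Qe; apply/eqP/mono.
Qed.

Lemma polychromatic e :
  ~~ monochromatic e ->
  exists P Q, [/\ contains P e, contains Q e & c P != c Q].
Proof.
case/forallPn => P /forallPn[Q].
by rewrite !negb_imply => /and3P[Pe Qe PQ]; exists P, Q.
Qed.

Lemma covered e : exists P, contains P e.
Proof.
have /separated[P [_ [_ /andP[Pe _] _]]] : e != (e.1, ~~ e.2).
  by case: e => i []; rewrite xpair_eqE andbF.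
by exists P.
Qed.

(** The color of a monochromatic edge determines it: two such edges of the same
color admit no pair of separating paths of distinct colors. *)
Lemma card_monochromatic : #|[set e | monochromatic e]| <= 3.
Proof.
pose col e := c (xchoose (covered e)).
have colE e P : monochromatic e -> contains P e -> col e = c P.
  move=> /monochromaticP mono Pe; apply: mono Pe.
  exact: (xchooseP (covered e)).
have col_inj : {in [set e | monochromatic e] &, injective col}.
  move=> e f; rewrite !inE => me mf ef; apply/eqP; apply: contraT.
  case/separated=> P [Q [PQ /andP[Pe _] /andP[Qf _]]].
  by move: PQ; rewrite -(colE e) // -(colE f) // ef eqxx.
by apply: leq_trans _ card_color; rewrite -(card_in_imset col_inj) max_card.
Qed.

Definition exceptional i := monochromatic (i, false) || monochromatic (i, true).

Lemma card_exceptional : #|[set i | exceptional i]| <= 3.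
Proof.
apply: leq_trans _ card_monochromatic.
apply: leq_trans _ (leq_imset_card fst _).
apply/subset_leq_card/subsetP=> i; rewrite inE => /orP[] mi; apply/imsetP.
  by exists (i, false); rewrite ?inE.
by exists (i, true); rewrite ?inE.
Qed.

Definition tips i := [set P | out P i && ~~ inn P i].
Definition inners i := [set P | inn P i].
Definition crossing := [set P | #|[set i | inn P i]| == 2].

(** These are the non-exceptional legs that would receive only 16 units if every
crossing path were split evenly. *)
Definition tight i :=
  [&& ~~ exceptional i, #|tips i| == 1, #|inners i| == 2
    & inners i \subset crossing].

(** Separating the two edges of the leg i from each other already forces a path
that is b_i alone. *)
Lemma own_leg i : exists P R,
  [/\ c P != c R, P \in inners i & ~~ out P i] /\ R \in tips i.
Proof.
have /separated[P [R [PR PA RB]]] : (i, false) != (i, true) :> L * bool.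
  by rewrite xpair_eqE andbF.
exists P, R; rewrite !inE PR.
by move: PA RB; rewrite /contains /= => /andP[-> ->] /andP[-> ->].
Qed.

Lemma card_tips i : 0 < #|tips i|.
Proof. by have [_ [R [_ Ri]]] := own_leg i; apply/card_gt0P; exists R. Qed.

Lemma card_inners i : 0 < #|inners i|.
Proof. by have [P [_ [[_ Pi _] _]]] := own_leg i; apply/card_gt0P; exists P. Qed.

Lemma card_inners_regular i : ~~ exceptional i -> 1 < #|inners i|.
Proof.
rewrite negb_or => /andP[/polychromatic[P [Q [Pi Qi PQ]]] _].
apply/card_gt1P; exists P, Q; rewrite !inE; split=> //.
by apply: contraNneq PQ => ->.
Qed.

Lemma card2_cover (A : {set T}) P Q S :
  #|A| = 2 -> P \in A -> Q \in A -> P != Q -> S \in A -> S = P \/ S = Q.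
Proof.
move=> A2 PA QA PQ.
have -> : A = [set P; Q].
  by apply/esym/eqP; rewrite eqEcard A2 cards2 PQ subUset !sub1set PA QA.
by rewrite !inE => /orP[]/eqP; [left|right].
Qed.

(** With P through a_i only, Q through both edges and R equal to b_i: the colors
of P and R differ because these are the only paths that separate a_i from b_i,
those of P and Q because a_i is not monochromatic, and those of Q and R because
b_i is not. *)
Lemma tight_structure i : tight i -> exists P Q R,
  [/\ [/\ inn P i, ~~ out P i, inn Q i & out Q i],
      [/\ c P != c Q, c P != c R & c Q != c R],
      forall S, inn S i -> S = P \/ S = Q
    & forall S, out S i -> S = Q \/ S = R].
Proof.
case/and4P=> reg /cards1P[R tipsE] /eqP inn2 _.
have [P [R' [[PR Pi nPo]]]] := own_leg i.
rewrite tipsE inE => /eqP ER; subst R'.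
have /setIdP[Ro nRi] : R \in tips i by rewrite tipsE inE.
move: reg; rewrite negb_or => /andP[polyA polyB].
have [Q [Qo Qi QR]] : exists Q, [/\ out Q i, inn Q i & c Q != c R].
  suff [Q Qo QR] : exists2 Q, out Q i & c Q != c R.
    exists Q; split=> //; apply: contraNT QR => nQi.
    have : Q \in tips i by rewrite inE Qo.
    by rewrite tipsE inE => /eqP ->.
  have [P1 [P2 [P1o P2o P12]]] := polychromatic polyB.
  case: (eqVneq (c P1) (c R)) => [E|]; last by exists P1.
  by exists P2 => //; rewrite -E eq_sym.
have PQ : P != Q by apply: contraNneq nPo => ->.
rewrite inE in Pi.
have only S : inn S i -> S = P \/ S = Q.
  by move=> Si; apply: card2_cover inn2 _ _ PQ _; rewrite inE.
exists P, Q, R; split=> //; first split=> //.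
  have [P1 [P2 [/only P1i /only P2i P12]]] := polychromatic polyA.
  by case: P1i P12 => ->; case: P2i => ->; rewrite ?eqxx // eq_sym.
move=> S So; case: (boolP (inn S i)) => Si.
  by left; case: (only S Si) => // SP; rewrite SP (negbTE nPo) in So.
right; have : S \in tips i by rewrite inE So.
by rewrite tipsE inE => /eqP.
Qed.

Lemma tight_other_path j S : tight j -> inn S j -> exists U,
  c U != c S /\ forall V, inn V j -> V = S \/ V = U.
Proof.
case/tight_structure=> P [Q [_ [_ [PQ _ _] only _]]] /only[] ->.
  by exists Q; rewrite eq_sym.
by exists P; split=> // V /only[]; [right|left].
Qed.

Lemma four_colors x1 x2 x3 x4 :
  c x1 != c x2 -> c x1 != c x3 -> c x2 != c x3 ->
  c x4 != c x1 -> c x4 != c x2 -> c x4 != c x3 -> False.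
Proof.
move=> h12 h13 h23 h41 h42 h43.
have /card_uniqP E : uniq [:: c x1; c x2; c x3; c x4].
  rewrite /= !inE !negb_or h12 h13 h23 /=.
  by rewrite ![_ == c x4]eq_sym h41 h42 h43.
have := leq_trans (max_card (mem [:: c x1; c x2; c x3; c x4])) card_color.
by rewrite E.
Qed.

(** Let U be the path through a_j other than S.  As S contains a_i, b_i and a_j,
the separation of a_j from a_i has to use U and the path P through a_i only,
and the separation of a_j from b_i has to use U and the path R equal to b_i.
The color of U then differs from those of P, R and S, which are three distinct
colors. *)
Lemma tight_not_joined i j S :
  i != j -> tight i -> tight j -> inn S i -> out S i -> inn S j -> False.
Proof.
move=> ij /tight_structure[P [Q [R [[Pi nPo Qi Qo] [PQ PR QR] onlyA onlyB]]]].
move=> tj Si So Sj; have [U [US onlyU]] := tight_other_path tj Sj.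
have SQ : S = Q by case: (onlyA S Si) => // E; rewrite E (negbTE nPo) in So.
subst S.
have /separated[P1 [P2 [c12 /andP[P1i nP1j] /andP[P2j nP2i]]]] :
    (i, false) != (j, false) :> L * bool by rewrite xpair_eqE (negbTE ij).
have /separated[P3 [P4 [c34 /andP[P3i nP3j] /andP[P4j nP4i]]]] :
    (i, true) != (j, false) :> L * bool by rewrite xpair_eqE (negbTE ij).
rewrite /contains /= in P1i nP1j P2j nP2i P3i nP3j P4j nP4i.
have E1 : P1 = P by case: (onlyA _ P1i) => // E; rewrite E Sj in nP1j.
have E2 : P2 = U by case: (onlyU _ P2j) => // E; rewrite E Si in nP2i.
have E3 : P3 = R by case: (onlyB _ P3i) => // E; rewrite E Sj in nP3j.
have E4 : P4 = U by case: (onlyU _ P4j) => // E; rewrite E So in nP4i.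
subst P1 P2 P3 P4.
by apply: (@four_colors P Q R U); rewrite // eq_sym.
Qed.

(** Charge, out of eight units, that the path P gives to the leg i.  A path
crossing between two legs is split 4 + 4, except that it gives 5 to a tight leg
of which it contains both edges, and 3 to the leg at its other end. *)
Definition share P i :=
  if ~~ inn P i then 8 * out P i
  else if P \notin crossing then 8
  else if tight i && out P i then 5
  else if [exists j, [&& j != i, inn P j, out P j & tight j]] then 3
  else 4.

Lemma share_path P : \sum_i share P i <= 8.
Proof.
case: (pickP (fun i => out P i && ~~ inn P i)) => [i /andP[Po nPi]|no_tip].
  rewrite (bigD1 i) //= big1 => [|j ji].
    by rewrite /share nPi Po.
  have nin (s : bool) : contains P (j, s) = false.
    apply/negbTE; apply: contraNN ji => /(tip_alone Po nPi)[-> _] //.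
  by rewrite /share (nin false : inn P j = _) (nin true : out P j = _).
have share0 i : i \notin [set i | inn P i] -> share P i = 0.
  rewrite inE /share => nPi; rewrite nPi.
  by move: (no_tip i); rewrite nPi andbT => ->.
rewrite (bigID (mem [set i | inn P i])) /= [X in _ + X]big1 // addn0.
case: (boolP (P \in crossing)) => Pc; last first.
  have Ple : #|[set i | inn P i]| <= 1.
    by move: Pc; rewrite inE => /eqP; have := card_legs P; lia.
  rewrite (eq_bigr (fun=> 8)) => [|i]; last first.
    by rewrite inE /share => ->; rewrite Pc.
  by rewrite sum_nat_const; lia.
have /cards2P[i [j [ij legsE]]] : #|[set i | inn P i]| == 2.
  by move: Pc; rewrite inE.
have Pi : inn P i by have := set21 i j; rewrite -legsE inE.
have Pj : inn P j by have := set22 i j; rewrite -legsE inE.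
rewrite legsE big_setU1 ?inE //= big_set1 /share Pi Pj Pc /=.
case: (boolP (tight i && out P i)) => [/andP[ti oi]|ni].
  have -> : tight j && out P j = false.
    apply/negbTE/negP=> /andP[tj _].
    exact: tight_not_joined ij ti tj Pi oi Pj.
  by case: existsP => // -[]; exists i; rewrite ij Pi oi ti.
case: (boolP (tight j && out P j)) => [/andP[tj oj]|nj].
  by case: existsP => // -[]; exists j; rewrite eq_sym ij Pj oj tj.
by do 2!case: ifP => _.
Qed.

Lemma sum_mem (A : {set T}) : \sum_P (P \in A : nat) = #|A|.
Proof.
rewrite -sum1_card [RHS]big_mkcond; apply: eq_bigr => P _.
by case: (P \in A).
Qed.

(** A path in [tips i], or through a_i but not crossing, gives 8 to the leg i,
and a crossing path gives at least 3 = 8 - 5. *)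
Lemma share_lower i :
  8 * #|tips i| + 8 * #|inners i| <=
  \sum_P share P i + 5 * #|inners i :&: crossing|.
Proof.
rewrite -!sum_mem !big_distrr /= -!big_split /=; apply: leq_sum => P _.
rewrite !inE /share inE.
by case: (inn P i) (out P i) (#|_| == 2) => [] [] [] //=;
   repeat case: ifP => _ //.
Qed.

(** The shares are 4 + 5 + 8.  The path through a_i only is split evenly: a
share of 3 would mean that its other leg is tight with both edges on the path,
and then it would be joined to the tight leg i. *)
Lemma share_tight i : tight i -> 17 <= \sum_P share P i.
Proof.
move=> ti; have [P [Q [R [[Pi nPo Qi Qo] [PQ PR QR] _ onlyB]]]] :=
  tight_structure ti.
have [nP nR] : P != Q /\ Q != R
  by split; [apply: contraNneq PQ => ->|apply: contraNneq QR => ->].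
have PR' : P != R by apply: contraNneq PR => ->.
case/and4P: (ti) => _ _ _ /subsetP sub.
have Pc : P \in crossing by apply: sub; rewrite inE.
have Qc : Q \in crossing by apply: sub; rewrite inE.
have PE : share P i = 4.
  rewrite /share Pi Pc (negbTE nPo) andbF /=; case: existsP => // -[j].
  case/and4P=> ji Pj Pjo tj.
  by case: (tight_not_joined ji tj ti Pj Pjo Pi).
have QE : share Q i = 5 by rewrite /share Qi Qc Qo ti.
rewrite (bigD1 P) //= (bigD1 Q) 1?eq_sym //= (bigD1 R) ?PE ?QE /=; last first.
  by rewrite ![R == _]eq_sym PR' nR.
have [_ [R' [_ ]]] := own_leg i.
rewrite inE => /andP[Ro nRi].
have ER : R' = R by case: (onlyB _ Ro) => // E; rewrite E Qi in nRi.
by subst R'; rewrite /share nRi Ro /= !addnA leq_addr.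
Qed.

(** Let t, r and d count the paths in [tips i], in [inners i] and in the
crossing part of [inners i].  The leg i receives at least 8 t + 8 (r - d) + 3 d, with
t >= 1 and r >= max 2 d, and this is smaller than 17 only if t = 1 and
r = d = 2, that is, if i is tight. *)
Lemma share_regular i : ~~ exceptional i -> 17 <= \sum_P share P i.
Proof.
move=> reg; case: (boolP (tight i)) => [/share_tight //|].
rewrite /tight reg /= => nt.
have := share_lower i; have := card_tips i; have := card_inners_regular reg.
have := subset_leq_card (subsetIl (inners i) crossing).
case: (boolP (inners i \subset crossing)) nt => [/setIidPl -> |nsub].
  by rewrite andbT; lia.
have : #|inners i :&: crossing| < #|inners i|.
  by apply: proper_card; rewrite properE subsetIl subsetI subxx.
by lia.
Qed.

(** The path b_i and one path through a_i already give 8 + 3.  The bound 9 is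
17 - 8, the value for which three exceptional legs cost 24 units in total. *)
Lemma share_any i : 9 <= \sum_P share P i.
Proof.
have := share_lower i; have := card_tips i; have := card_inners i.
by have := subset_leq_card (subsetIl (inners i) crossing); lia.
Qed.

Lemma discharging : 17 * #|L| <= 8 * #|T| + 24.
Proof.
have lower : 17 * #|L| <=
    \sum_i \sum_P share P i + 8 * #|[set i | exceptional i]|.
  rewrite -(sum1dep_card exceptional) (big_mkcond exceptional) big_distrr.
  rewrite -big_split mulnC -sum_nat_const; apply: leq_sum => i _ /=.
  case: ifPn => [_|/share_regular]; last by rewrite muln0 addn0.
  by have := share_any i; lia.
have upper : \sum_i \sum_P share P i <= 8 * #|T|.
  rewrite exchange_big mulnC -sum_nat_const; apply: leq_sum => P _.
  exact: share_path.
by have := card_exceptional; lia.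
Qed.
End Discharging.

(** * Edges of a path in a simple graph *)

Section Paths.
Variable G : sgraph.
Implicit Types (p : seq G) (u v w : G).

Lemma set2_inj u v w z :
  [set u; v] = [set w; z] -> u = w /\ v = z \/ u = z /\ v = w.
Proof.
move=> E.
have /set2P uE : u \in [set w; z] by rewrite -E set21.
have /set2P vE : v \in [set w; z] by rewrite -E set22.
have /set2P wE : w \in [set u; v] by rewrite E set21.
have /set2P zE : z \in [set u; v] by rewrite E set22.
by case: uE; case: vE; case: wE; case: zE; intuition congruence.
Qed.

Lemma path_edgesP p e : e \in path_edges p ->
  exists p1 u v p2, p = p1 ++ [:: u, v & p2] /\ e = [set u; v].
Proof.
case: p => // x s /=; elim: s x => //= y s IHs x; rewrite inE.
case/orP=> [/eqP ->|/IHs[p1 [u [v [p2 [-> ->]]]]]].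
  by exists [::], x, y, s.
by exists (x :: p1), u, v, p2.
Qed.

Lemma mem_path_edges p1 u v p2 :
  [set u; v] \in path_edges (p1 ++ [:: u, v & p2]).
Proof.
elim: p1 => [|x p1 IH]; first by rewrite /= mem_head.
by case: p1 IH => [|y p1] /= IH; rewrite inE IH orbT.
Qed.

Lemma path_edges_index p u v : uniq p -> [set u; v] \in path_edges p ->
  u \in p /\ (index v p = (index u p).+1 \/ index u p = (index v p).+1).
Proof.
move=> Up /path_edgesP[p1 [w [z [p2 [pE uvE]]]]].
have iw : index w p = size p1.
  have {1}-> : w = nth w p (size p1) by rewrite pE nth_cat ltnn subnn.
  by rewrite index_uniq // pE size_cat /=; lia.
have iz : index z p = (size p1).+1.
  have {1}-> : z = nth w p (size p1).+1.
    by rewrite pE nth_cat ltnNge leqnSn /= subSnn.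
  by rewrite index_uniq // pE size_cat /=; lia.
have wp : w \in p by rewrite pE mem_cat inE eqxx orbT.
have zp : z \in p by rewrite pE mem_cat !inE eqxx !orbT.
by case: (set2_inj uvE) => -[-> ->]; rewrite iw iz; auto.
Qed.

End Paths.

(** * Paths in the spider with legs of length two *)

Section Spider.
Variable q : nat.
Implicit Types (i j : 'I_q) (p : seq (spider2 q)).

Definition center : spider2 q := None.
Definition mid i : spider2 q := Some (existT (fun _ : 'I_q => 'I_2) i ord0).
Definition leaf i : spider2 q := Some (existT (fun _ : 'I_q => 'I_2) i ord_max).

Lemma mid_inj : injective mid.
Proof. by move=> i j /(congr1 (omap (@tag _ _)))[]. Qed.

Variant spider2_spec : spider2 q -> Type :=
  | IsCenter : spider2_spec center
  | IsMid i : spider2_spec (mid i)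
  | IsLeaf i : spider2_spec (leaf i).

Lemma spider2P u : spider2_spec u.
Proof.
case: u => [[i [[|[|//]] lt_k]]|]; last exact: IsCenter.
  by rewrite (_ : Ordinal _ = ord0); [exact: IsMid | apply: val_inj].
by rewrite (_ : Ordinal _ = ord_max); [exact: IsLeaf | apply: val_inj].
Qed.

Lemma adj_mid i w : adj (mid i) w -> w = center \/ w = leaf i.
Proof.
case: (spider2P w) => [|j|j]; first by left.
  by rewrite /= /spider_adj /= !andbF.
by rewrite /= /spider_adj /= andbT andbF orbF => /eqP ->; right.
Qed.

Lemma adj_leaf i w : adj (leaf i) w -> w = mid i.
Proof.
case: (spider2P w) => [//|j|j]; rewrite /= /spider_adj /= !andbF //=.
by rewrite andbT => /eqP ->.
Qed.

Definition inner i : {set spider2 q} := [set center; mid i].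
Definition outer i : {set spider2 q} := [set mid i; leaf i].

Definition leg_edge (e : 'I_q * bool) := if e.2 then outer e.1 else inner e.1.

Lemma leg_edge_inj : injective leg_edge.
Proof.
case=> i [] [j []] /set2_inj[[E1 E2]|[E1 E2]] //.
- by move/mid_inj: E1 => /= ->.
by move/mid_inj: E2 => /= ->.
Qed.

Lemma leg_edge_edges e : leg_edge e \in edges (spider2 q).
Proof.
case: e => i []; apply/imsetP.
  by exists (mid i, leaf i); rewrite // inE /= /spider_adj /= eqxx.
by exists (center, mid i); rewrite // inE.
Qed.

(** Extending the edge b_i beyond its leaf is impossible, and extending it
beyond its inner vertex leads to the center, through a_i. *)
Lemma path_tip_alone p i : is_path p ->
  outer i \in path_edges p -> inner i \notin path_edges p ->
  path_edges p = [:: outer i].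
Proof.
case/and3P=> _ sp Up /path_edgesP[p1 [u [v [p2 [pE uvE]]]]] noinner.
have before w p0 : p <> p0 ++ [:: w, u, v & p2].
  move=> E; move: noinner sp Up; rewrite E sorted_cat_cons cat_uniq /=.
  move=> noinner /and3P[_ wu _] /and3P[_ _ /andP[]]; rewrite !inE !negb_or.
  case/and3P=> /eqP wnu /eqP wnv _ _.
  case: (set2_inj uvE) => -[mu lv]; subst u v.
    rewrite spider_adj_sym in wu; case: (adj_mid wu) => // wE.
    by case/negP: noinner; rewrite wE; apply: mem_path_edges.
  by rewrite spider_adj_sym in wu; case: wnv; apply: adj_leaf.
have after w p3 : p <> p1 ++ [:: u, v, w & p3].
  move=> E; move: noinner sp Up; rewrite E sorted_cat_cons cat_uniq /=.
  move=> noinner /and4P[_ _ vw _] /and3P[_ _ /and3P[]]; rewrite !inE !negb_or.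
  case/and3P=> _ /eqP unw _ /andP[/eqP vnw _] _.
  case: (set2_inj uvE) => -[mu lv]; subst u v.
    by case: unw; rewrite (adj_leaf vw).
  case: (adj_mid vw) => [wE|/esym //]; case/negP: noinner.
  by rewrite -cat_rcons wE /inner setUC; apply: mem_path_edges.
case: p2 pE before after => [|w p2] -> before after; last by case: (after w p2).
case: (lastP p1) before {after} => [|p0 w] before; first by rewrite /= uvE.
by case: (before w p0); rewrite cat_rcons.
Qed.

(** If a_i lies on the path, the position of its outer end differs by one from
that of the center, which leaves two values. *)
Lemma path_card_inner p : uniq p ->
  #|[set i | inner i \in path_edges p]| <= 2.
Proof.
move=> Up; rewrite leqNgt; apply/negP=> /card_gt2P[i [j [k [[+ + +] []]]]].
have inner_index l : l \in [set i | inner i \in path_edges p] ->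
    mid l \in p /\
    (index (mid l) p = (index center p).+1 \/
     index center p = (index (mid l) p).+1).
  by rewrite inE {1}/inner setUC => /(path_edges_index Up)[lp]; intuition.
have index_neq l r : mid l \in p -> mid r \in p -> l != r ->
    index (mid l) p <> index (mid r) p.
  by move=> lp rp + E; rewrite (mid_inj (index_inj center lp rp E)) eqxx.
move=> /inner_index[ip Ei] /inner_index[jp Ej] /inner_index[kp Ek] ij jk ki.
have := index_neq _ _ ip jp ij; have := index_neq _ _ jp kp jk.
have := index_neq _ _ kp ip ki.
by lia.
Qed.

End Spider.

(** * The lower bound *)

Local Open Scope ring_scope.

Theorem theorem3p4 (n q : nat) (hn : n = (2 * q + 1)%N) :
  (17 * (n%:R - 1) / 16 - 3 : rat)
    <= (rainbow_sep_number (spider2 q) (isT : (1 < 3)%N))%:R.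
Proof.
rewrite /rainbow_sep_number.
case: ex_minnP => _ /asboolP[P [Ppath [c sep]] <-] _.
pose thru E (a : 'I_(size P)) (i : 'I_q) := E i \in path_edges (nth [::] P a).
have thruE a e : contains (thru (@inner q)) (thru (@outer q)) a e =
    (leg_edge e \in path_edges (nth [::] P a)) by case: e => i [].
have isP (a : 'I_(size P)) : is_path (nth [::] P a).
  by apply: (allP Ppath); rewrite mem_nth.
have bound : (17 * q <= 8 * size P + 24)%N.
  rewrite -[X in (17 * X)%N](card_ord q) -[size P]card_ord.
  apply: (@discharging _ _ _ (thru (@inner q)) (thru (@outer q)) c).
  - by rewrite card_ord.
  - move=> a i e ao ai; rewrite thruE (path_tip_alone (isP a) ao ai) inE.
    by move/eqP/(@leg_edge_inj q e (i, true)).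
  - by move=> a; apply: path_card_inner; case/and3P: (isP a).
  move=> e f ef.
  have [|a [b [cab ea fb]]] := sep _ _ (leg_edge_edges e) (leg_edge_edges f).
    by rewrite (inj_eq (@leg_edge_inj q)).
  by exists a, b; rewrite !thruE.
have : (17 * q)%:R <= (8 * size P + 24)%:R :> rat by rewrite ler_nat.
by rewrite hn (natrD _ (2 * q)) (natrD _ (8 * size P)) !natrM; lra.
Qed.
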